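(* Let $A$ be a Poisson Hopf algebra, and give its Poisson enveloping algebra $\mathcal{U}(A)$ the bialgebra structure (due to Oh) for which $a\mapsto m_a$ embeds $A$ as a sub-bialgebra. (iii) If $A$ is pointed, then $\mathcal{U}(A)$ is a Hopf algebra with sub-Hopf algebra $A$, and the group-likes satisfy $G(\mathcal{U}(A))=G(A)$. (iv) If $A$ is a connected Hopf algebra, then so is $\mathcal{U}(A)$.
   Context: A Poisson Hopf algebra is a commutative Hopf algebra with a Lie bracket satisfying $\{ab,c\}=a\{b,c\}+\{a,c\}b$ such that $\Delta$ is a Poisson morphism (with $\{a\otimes b,c\otimes d\}=\{a,c\}\otimes bd+ac\otimes\{b,d\}$ on $A\otimes A$). $\mathcal{U}(A)$ is the unital algebra generated by copies $m_a,h_a$ ($a\in A$, linear in $a$) with relations $m_{xy}=m_xm_y$, $h_{\{x,y\}}=h_xh_y-h_yh_x$, $h_{xy}=m_yh_x+m_xh_y$, $m_{\{x,y\}}=h_xm_y-m_yh_x$, $m_1=1$. Its bialgebra structure is given by $\Delta(m_a)=\sum m_{a_1}\otimes m_{a_2}$, $\Delta(h_a)=\sum(h_{a_1}\otimes m_{a_2}+m_{a_1}\otimes h_{a_2})$, $\epsilon(m_a)=\epsilon(a)$, $\epsilon(h_a)=0$, where $\Delta(a)=\sum a_1\otimes a_2$; with this structure the coradical of $\mathcal{U}(A)$ equals the coradical of $A$. A coalgebra is pointed if all its simple subcoalgebras are one-dimensional, and a Hopf algebra is connected if its coradical is $\Bbbk$. *)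

(* Defs.v *)
From HB Require Import structures.
From mathcomp Require Import all_boot all_order all_algebra.
Set Implicit Arguments. Unset Strict Implicit. Unset Printing Implicit Defensive.
Import Order.TTheory GRing.Theory.
Local Open Scope ring_scope.

Section PHopf.
Variable K : fieldType.

(* An element of U (x) V is written as a finite list of pairs (u_i, v_i),  *)
(* standing for sum_i u_i (x) v_i.  Two lists denote the same tensor iff   *)
(* they agree under every bilinear map (universal property of U (x) V).    *)

Definition bilin (U V W : lmodType K) (f : U -> V -> W) : Prop :=
  (forall v a x y, f (a *: x + y) v = a *: f x v + f y v) /\
  (forall u a x y, f u (a *: x + y) = a *: f u x + f u y).

Definition teq (U V : lmodType K) (s t : seq (U * V)) : Prop :=
  forall (W : lmodType K) (f : U -> V -> W), bilin f ->
    \sum_(p <- s) f p.1 p.2 = \sum_(p <- t) f p.1 p.2.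

Definition trilin (U V X W : lmodType K) (f : U -> V -> X -> W) : Prop :=
  (forall v z a x y, f (a *: x + y) v z = a *: f x v z + f y v z) /\
  (forall u z a x y, f u (a *: x + y) z = a *: f u x z + f u y z) /\
  (forall u v a x y, f u v (a *: x + y) = a *: f u v x + f u v y).

Definition teq3 (U V X : lmodType K) (s t : seq (U * V * X)) : Prop :=
  forall (W : lmodType K) (f : U -> V -> X -> W), trilin f ->
    \sum_(p <- s) f p.1.1 p.1.2 p.2 = \sum_(p <- t) f p.1.1 p.1.2 p.2.

Definition tscale (U V : lmodType K) (c : K) (t : seq (U * V)) : seq (U * V) :=
  [seq (c *: p.1, p.2) | p <- t].

Definition tmul (U V : algType K) (s t : seq (U * V)) : seq (U * V) :=
  [seq (p.1 * q.1, p.2 * q.2) | p <- s, q <- t].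

Section Coalg.
Variable V : lmodType K.
Variable D : V -> seq (V * V).
Variable e : V -> K.

Definition is_coalg : Prop :=
  (forall a x y, teq (D (a *: x + y)) (tscale a (D x) ++ D y)) /\
  (forall a x y, e (a *: x + y) = a * e x + e y) /\
  (forall x, teq3 [seq (p.1, q.1, q.2) | p <- D x, q <- D p.2]
                  [seq (q.1, q.2, p.2) | p <- D x, q <- D p.1]) /\
  (forall x, \sum_(p <- D x) e p.1 *: p.2 = x /\ \sum_(p <- D x) e p.2 *: p.1 = x).

Definition subspace (C : V -> Prop) : Prop :=
  C 0 /\ forall a x y, C x -> C y -> C (a *: x + y).

Definition in_tensor (C : V -> Prop) (t : seq (V * V)) : Prop :=
  exists t' : seq (V * V), teq t t' /\ forall p, p \in t' -> C p.1 /\ C p.2.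

Definition subcoalg (C : V -> Prop) : Prop :=
  subspace C /\ forall x, C x -> in_tensor C (D x).

Definition simple_subcoalg (C : V -> Prop) : Prop :=
  subcoalg C /\ (exists x, C x /\ x != 0) /\
  forall C', subcoalg C' -> (forall x, C' x -> C x) ->
    (exists x, C' x /\ x != 0) -> forall x, C x -> C' x.

Definition pointed : Prop :=
  forall C, simple_subcoalg C ->
    exists g, g != 0 /\ forall x, C x <-> exists a : K, x = a *: g.

Definition coradical (x : V) : Prop :=
  exists s : seq V, (forall y, y \in s -> exists C, simple_subcoalg C /\ C y) /\
                    x = \sum_(y <- s) y.

Definition grouplike (g : V) : Prop := g != 0 /\ teq (D g) [:: (g, g)].

End Coalg.

Section Bialg.
Variable H : algType K.
Variable D : H -> seq (H * H).
Variable e : H -> K.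

Definition is_bialg : Prop :=
  is_coalg D e /\
  (forall x y, teq (D (x * y)) (tmul (D x) (D y))) /\ teq (D 1) [:: (1, 1)] /\
  (forall x y, e (x * y) = e x * e y) /\ e 1 = 1.

Definition is_antipode (S : H -> H) : Prop :=
  (forall a x y, S (a *: x + y) = a *: S x + S y) /\
  forall x, \sum_(p <- D x) S p.1 * p.2 = e x *: 1 /\
            \sum_(p <- D x) p.1 * S p.2 = e x *: 1.

Definition is_hopf (S : H -> H) : Prop := is_bialg /\ is_antipode S.

Definition connected : Prop :=
  forall x, coradical D x <-> exists a : K, x = a *: 1.

End Bialg.

Section Poisson.
Variable A : comAlgType K.
Variable pb : A -> A -> A.

Definition is_poisson : Prop :=
  bilin pb /\ (forall a, pb a a = 0) /\
  (forall a b c, pb a (pb b c) + pb b (pb c a) + pb c (pb a b) = 0) /\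
  (forall a b c, pb (a * b) c = a * pb b c + pb a c * b).

Definition tbracket (s t : seq (A * A)) : seq (A * A) :=
  flatten [seq [:: (pb p.1 q.1, p.2 * q.2); (p.1 * q.1, pb p.2 q.2)]
          | p <- s, q <- t].

Definition is_poisson_hopf (D : A -> seq (A * A)) (e : A -> K) (S : A -> A) :=
  is_hopf D e S /\ is_poisson /\
  forall a b, teq (D (pb a b)) (tbracket (D a) (D b)).

Definition pea_rel (B : algType K) (m h : A -> B) : Prop :=
  (forall c x y, m (c *: x + y) = c *: m x + m y) /\
  (forall c x y, h (c *: x + y) = c *: h x + h y) /\
  (forall x y, m (x * y) = m x * m y) /\
  (forall x y, h (pb x y) = h x * h y - h y * h x) /\
  (forall x y, h (x * y) = m y * h x + m x * h y) /\
  (forall x y, m (pb x y) = h x * m y - m y * h x) /\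
  m 1 = 1.

Definition alg_morph (B C : algType K) (f : B -> C) : Prop :=
  (forall c x y, f (c *: x + y) = c *: f x + f y) /\
  (forall x y, f (x * y) = f x * f y) /\ f 1 = 1.

(* (U, m, h) is the Poisson enveloping algebra U(A): the unital algebra   *)
(* generated by the m_a, h_a subject to the relations, i.e. the initial   *)
(* object among algebras equipped with maps satisfying the relations.     *)
Definition is_PEA (U : algType K) (m h : A -> U) : Prop :=
  pea_rel m h /\
  forall (B : algType K) (m' h' : A -> B), pea_rel m' h' ->
    exists f : U -> B, alg_morph f /\ (forall a, f (m a) = m' a) /\
      (forall a, f (h a) = h' a) /\
      forall g : U -> B, alg_morph g -> (forall a, g (m a) = m' a) ->
        (forall a, g (h a) = h' a) -> forall x, g x = f x.

Definition oh_bialg (U : algType K) (m h : A -> U)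
  (DA : A -> seq (A * A)) (eA : A -> K)
  (DU : U -> seq (U * U)) (eU : U -> K) : Prop :=
  is_bialg DU eU /\
  (forall a, teq (DU (m a)) [seq (m p.1, m p.2) | p <- DA a]) /\
  (forall a, teq (DU (h a))
     (flatten [seq [:: (h p.1, m p.2); (m p.1, h p.2)] | p <- DA a])) /\
  (forall a, eU (m a) = eA a) /\ (forall a, eU (h a) = 0).

End Poisson.
End PHopf.

(* Main.v *)
(** U acts on A by letting m_a multiply and h_a act as {a, -}; the orbit map of
    1 is a linear retraction r of m.  Counting the h's in a monomial filters U
    into subspaces F_n, with F_0 = m(A) and D(F_n) inside the sum of the
    F_i (x) F_(n-i).  If C is a nonzero subcoalgebra, x in C has minimal
    degree n > 0 and phi is a functional killing F_0 with phi(x) = 1, then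
    (phi (x) id)(D x) is a nonzero element of C of smaller degree; so C meets
    m(A), and C lies in m(A) if it is simple.  This gives the group-likes and
    connectedness.  For the antipode (Takeuchi), id * (m SA r) and
    (m SA r) * id agree with the convolution unit on F_0, hence are invertible
    by a geometric series that is finite on each F_n. *)
Require Import Defs.
From HB Require Import structures.
From mathcomp Require Import all_boot all_order all_algebra.
From mathcomp Require Import boolp classical_sets.
Set Implicit Arguments. Unset Strict Implicit. Unset Printing Implicit Defensive.
Import GRing.Theory.
Local Open Scope ring_scope.

(** * Linear maps and subspaces given as predicates *)

Section LinearMaps.
Variables (K : fieldType) (V W : lmodType K) (f : V -> W).
Hypothesis lf : linear f.

Lemma lin0 : f 0 = 0.
Proof.
have := lf 1 0 0; rewrite scale1r addr0 scale1r => e.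
by apply: (@addrI _ (f 0)); rewrite addr0 -e.
Qed.

Lemma linD x y : f (x + y) = f x + f y.
Proof. by rewrite -[x in LHS]scale1r lf scale1r. Qed.

Lemma linZ a x : f (a *: x) = a *: f x.
Proof. by rewrite -[a *: x]addr0 lf lin0 addr0. Qed.

Lemma linN x : f (- x) = - f x.
Proof. by rewrite -scaleN1r linZ scaleN1r. Qed.

Lemma linB x y : f (x - y) = f x - f y.
Proof. by rewrite linD linN. Qed.

Lemma lin_sum (I : Type) (r : seq I) (P : pred I) (F : I -> V) :
  f (\sum_(i <- r | P i) F i) = \sum_(i <- r | P i) f (F i).
Proof. exact: (big_morph f linD lin0). Qed.

End LinearMaps.

Lemma linear_comp (K : fieldType) (U V W : lmodType K)
  (f : V -> W) (g : U -> V) : linear f -> linear g -> linear (fun x => f (g x)).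
Proof. by move=> lf lg a x y; rewrite lg lf. Qed.

Section Subspaces.
Variables (K : fieldType) (V : lmodType K) (C : V -> Prop).
Hypothesis sC : subspace C.

Lemma subspaceD x y : C x -> C y -> C (x + y).
Proof. by move=> Cx Cy; rewrite -[x]scale1r; apply: sC.2. Qed.

Lemma subspaceZ a x : C x -> C (a *: x).
Proof. by move=> Cx; rewrite -[_ *: _]addr0; apply: sC.2 => //; apply: sC.1. Qed.

Lemma subspaceN x : C x -> C (- x).
Proof. by move=> Cx; rewrite -scaleN1r; apply: subspaceZ. Qed.

Lemma subspace_sum (I : eqType) (r : seq I) (F : I -> V) :
  (forall i, i \in r -> C (F i)) -> C (\sum_(i <- r) F i).
Proof.
move=> CF; rewrite big_seq; elim/big_ind: _ => //; first exact: sC.1.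
exact: subspaceD.
Qed.

End Subspaces.

(** * Algebras of endomorphisms preserving a subspace *)

Section StableEndomorphisms.
Variables (K : fieldType) (V : algType K) (W : V -> Prop).

(** These operator algebras are the targets to which the universal property of [U] is applied.
    Taking [V] to be an algebra ensures [1 != 0] among the operators; taking [W] to be everything
    gives all endomorphisms. *)
Record stab_end (sW : subspace W) := StabEnd {
  stab_fun :> V -> V;
  stab_lin : linear stab_fun;
  stab_stable : forall x, W x -> W (stab_fun x) }.

Variable sW : subspace W.
Local Notation E := (stab_end sW).

Lemma stab_endP (f g : E) : stab_fun f =1 stab_fun g -> f = g.
Proof.
case: f g => [f lf sf] [g lg sg] /= /funext fg.
by subst g; congr StabEnd; apply: Prop_irrelevance.
Qed.

Let zero_lin : linear (fun _ : V => 0 : V).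
Proof. by move=> a x y; rewrite scaler0 addr0. Qed.
Let zero : E := StabEnd sW zero_lin (fun _ _ => sW.1).

Let add_lin (f g : E) : linear (fun x => f x + g x).
Proof. by move=> a x y; rewrite !stab_lin scalerDr addrACA. Qed.
Let add (f g : E) : E := StabEnd sW (add_lin f g)
  (fun x Wx => subspaceD sW (stab_stable f Wx) (stab_stable g Wx)).

Let scale_lin c (f : E) : linear (fun x => c *: f x).
Proof. by move=> a x y; rewrite !stab_lin scalerDr !scalerA mulrC. Qed.
Let scale c (f : E) : E := StabEnd sW (scale_lin c f)
  (fun x Wx => subspaceZ sW c (stab_stable f Wx)).

Let one_lin : linear (fun x : V => x).
Proof. by []. Qed.
Let one : E := StabEnd sW one_lin (fun x Wx => Wx).

Let mul (f g : E) : E := StabEnd sW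
  (linear_comp (stab_lin f) (stab_lin g))
  (fun x Wx => stab_stable f (stab_stable g Wx)).

HB.instance Definition _ := gen_eqMixin E.
HB.instance Definition _ := gen_choiceMixin E.

Let addA : associative add.
Proof. by move=> f g h; apply: stab_endP => x /=; rewrite addrA. Qed.
Let addC : commutative add.
Proof. by move=> f g; apply: stab_endP => x /=; rewrite addrC. Qed.
Let add0 : left_id zero add.
Proof. by move=> f; apply: stab_endP => x /=; rewrite add0r. Qed.
Let addN : left_inverse zero (scale (-1)) add.
Proof. by move=> f; apply: stab_endP => x /=; rewrite scaleN1r addNr. Qed.

HB.instance Definition _ := GRing.isZmodule.Build E addA addC add0 addN.

Let mulA : associative mul. Proof. by move=> f g h; apply: stab_endP. Qed.
Let mul1 : left_id one mul. Proof. by move=> f; apply: stab_endP. Qed.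
Let mulx1 : right_id one mul. Proof. by move=> f; apply: stab_endP. Qed.
Let mulDl : left_distributive mul +%R.
Proof. by move=> f g h; apply: stab_endP. Qed.
Let mulDr : right_distributive mul +%R.
Proof. by move=> f g h; apply: stab_endP => x /=; rewrite (linD (stab_lin f)). Qed.
Let one_neq0 : one != 0.
Proof.
apply/eqP => /(congr1 (fun f : E => f 1)) /= /eqP; exact/negP/oner_neq0.
Qed.

HB.instance Definition _ :=
  GRing.Zmodule_isNzRing.Build E mulA mul1 mulx1 mulDl mulDr one_neq0.

Let scaleA a b f : scale a (scale b f) = scale (a * b) f.
Proof. by apply: stab_endP => x /=; rewrite scalerA. Qed.
Let scale1 : left_id 1 scale.
Proof. by move=> f; apply: stab_endP => x /=; rewrite scale1r. Qed.
Let scaleDr : right_distributive scale +%R.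
Proof. by move=> a f g; apply: stab_endP => x /=; rewrite scalerDr. Qed.
Let scaleDl f : {morph scale^~ f : a b / a + b}.
Proof. by move=> a b; apply: stab_endP => x /=; rewrite scalerDl. Qed.

HB.instance Definition _ :=
  GRing.Zmodule_isLmodule.Build K E scaleA scale1 scaleDr scaleDl.

Let scaleAl a (f g : E) : a *: (f * g) = (a *: f) * g.
Proof. exact: stab_endP. Qed.
HB.instance Definition _ := GRing.Lmodule_isLalgebra.Build K E scaleAl.

Let scaleAr a (f g : E) : a *: (f * g) = f * (a *: g).
Proof. by apply: stab_endP => x /=; rewrite (linZ (stab_lin f)). Qed.
HB.instance Definition _ := GRing.Lalgebra_isAlgebra.Build K E scaleAr.

Lemma stab_addE (f g : E) x : (f + g) x = f x + g x. Proof. by []. Qed.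
Lemma stab_oppE (f : E) x : (- f) x = - f x. Proof. by rewrite /= scaleN1r. Qed.
Lemma stab_mulE (f g : E) x : (f * g) x = f (g x). Proof. by []. Qed.
Lemma stab_scaleE c (f : E) x : (c *: f) x = c *: f x. Proof. by []. Qed.

End StableEndomorphisms.


(** * Functionals separating a point from a subspace *)

Section Functionals.
Variables (K : fieldType) (V : lmodType K).

(** Zorn's lemma gives a maximal subspace [N] containing [W] and avoiding [x]. Maximality forces V =
    N + Kx, and [phi] reads off the coordinate along [x]. *)
Lemma separating_functional (W : V -> Prop) (x : V) :
  subspace W -> ~ W x ->
  exists phi : V -> K^o,
    [/\ linear phi, forall y, W y -> phi y = 0 & phi x = 1].
Proof.
move=> sW nWx.
(* Imposing the condition on the union with [W] lets the empty chain satisfy it. *)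
pose P (M : set V) := subspace (M `|` W)%classic /\ ~ (M `|` W)%classic x.
have [F PF totF|M [[sM nMx] maxM]] := @Zorn_bigcup V P.
  split; last by case=> [[M FM Mx]|//]; case: (PF M FM) => _; apply; left.
  split; first by right; apply: sW.1.
  move=> a y z [[M FM My]|Wy] [[N FN Nz]|Wz].
  - have [MN|NM] := totF M N FM FN.
      have [s _] := PF N FN.
      by case: (s.2 a y z (or_introl (MN _ My)) (or_introl Nz)) => ?;
        [left; exists N|right].
    have [s _] := PF M FM.
    by case: (s.2 a y z (or_introl My) (or_introl (NM _ Nz))) => ?;
      [left; exists M|right].
  - have [s _] := PF M FM.
    by case: (s.2 a y z (or_introl My) (or_intror Wz)) => ?;
      [left; exists M|right].
  - have [s _] := PF N FN.
    by case: (s.2 a y z (or_intror Wy) (or_introl Nz)) => ?;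
      [left; exists N|right].
  - by right; apply: sW.2.
pose N := (M `|` W)%classic.
have Nsum y : exists c, N (y - c *: x).
  apply: contrapT => /forallNP nN.
  (* [B] is N + Ky. If [y] is outside N + Kx, then [B] is strictly larger than [M] and still avoids
     [x], against maximality. *)
  pose B : set V := fun z => exists c, N (z - c *: y).
  have NB z : N z -> B z by exists 0; rewrite scale0r subr0.
  have BWB : (B `|` W)%classic = B.
    by apply/seteqP; split=> z; [case=> // Wz; apply: NB; right|left].
  apply: (maxM B); first split.
  - by move=> z Mz; apply: NB; left.
  - move=> BM; apply: (nN 0); rewrite scale0r subr0; left; apply: BM.
    by exists 1; rewrite scale1r subrr; apply: sM.1.
  - rewrite /P BWB; split; last first.
      case=> c Nxcy; have [c0|c0] := eqVneq c 0.
        by apply: nMx; rewrite -[x]subr0 -(scale0r y) -c0.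
      apply: (nN c^-1).
      have -> : y - c^-1 *: x = (- c^-1) *: (x - c *: y).
        by rewrite scalerBr scalerA mulNr mulVf // scaleN1r opprK scaleNr addrC.
      exact: subspaceZ.
    split; first by apply: NB; apply: sM.1.
    move=> a u v [c Nu] [d Nv]; exists (a * c + d).
    have -> : a *: u + v - (a * c + d) *: y = a *: (u - c *: y) + (v - d *: y).
      by rewrite scalerBr scalerA scalerDl opprD addrACA.
    exact: sM.2.
have [phi phiP] := choice Nsum.
have phi_uniq y c : N (y - c *: x) -> phi y = c.
  move=> Nc; apply/eqP; rewrite -subr_eq0; apply/eqP; apply: contrapT => /eqP nz.
  apply: nMx; rewrite -[x](scalerK nz); apply: (subspaceZ sM).
  have -> : (phi y - c) *: x = (y - c *: x) - (y - phi y *: x).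
    by rewrite scalerBl opprB [RHS]addrC addrA subrK.
  by apply: subspaceD => //; apply: subspaceN => //; apply: phiP.
exists phi; split.
- move=> a y z; apply: phi_uniq.
  have -> : a *: y + z - (a * phi y + phi z) *: x =
            a *: (y - phi y *: x) + (z - phi z *: x).
    by rewrite scalerBr scalerA scalerDl opprD addrACA.
  by apply: sM.2; apply: phiP.
- by move=> y Wy; apply: phi_uniq; rewrite scale0r subr0; right.
- by apply: phi_uniq; rewrite scale1r subrr; apply: sM.1.
Qed.

End Functionals.

(** * Tensors as lists of pairs, and their slices *)

Section Tensors.
Variable K : fieldType.

Section Basic.
Variables U V : lmodType K.
Implicit Types s t : seq (U * V).

Lemma teq_sym s t : teq s t -> teq t s.
Proof. by move=> st W f bf; rewrite st. Qed.

Lemma teq_trans t s u : teq s t -> teq t u -> teq s u.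
Proof. by move=> st tu W f bf; rewrite st // tu. Qed.

Lemma perm_teq s t : perm_eq s t -> teq s t.
Proof. by move=> st W f _; apply: perm_big. Qed.

Lemma teq_cat s1 t1 s2 t2 : teq s1 t1 -> teq s2 t2 -> teq (s1 ++ s2) (t1 ++ t2).
Proof. by move=> e1 e2 W f bf; rewrite !big_cat e1 // e2. Qed.

Lemma bilin_l (W : lmodType K) (f : U -> V -> W) v :
  bilin f -> linear (fun u => f u v).
Proof. by move=> [b _] a x y; apply: b. Qed.

Lemma bilin_r (W : lmodType K) (f : U -> V -> W) u : bilin f -> linear (f u).
Proof. by move=> [_ b] a x y; apply: b. Qed.

Lemma teq_tscale a s t : teq s t -> teq (tscale a s) (tscale a t).
Proof.
move=> st W f bf; rewrite !big_map /=.
under eq_bigr do rewrite (linZ (bilin_l _ bf)).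
under [RHS]eq_bigr do rewrite (linZ (bilin_l _ bf)).
by rewrite -!scaler_sumr st.
Qed.

Lemma teq_map (U' V' : lmodType K) (f : U -> U') (g : V -> V') s t :
  linear f -> linear g -> teq s t ->
  teq [seq (f p.1, g p.2) | p <- s] [seq (f p.1, g p.2) | p <- t].
Proof.
move=> lf lg st W F [b1 b2]; rewrite !big_map /=.
apply: (st W (fun u v => F (f u) (g v))).
by split=> [v|u] a x y; rewrite ?lf ?lg ?b1 ?b2.
Qed.

Definition tswap s : seq (V * U) := [seq (p.2, p.1) | p <- s].

Lemma tswap_teq s t : teq s t -> teq (tswap s) (tswap t).
Proof.
move=> st W F [b1 b2]; rewrite !big_map /=.
by apply: (st W (fun u v => F v u)); split.
Qed.

Lemma teq_slice_l (phi : U -> K^o) s t : linear phi -> teq s t ->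
  \sum_(p <- s) phi p.1 *: p.2 = \sum_(p <- t) phi p.1 *: p.2.
Proof.
move=> lphi st; apply: (st V (fun u v => phi u *: v)).
split=> [v|u] a x y; rewrite ?lphi ?scalerDl ?scalerDr ?scalerA //.
by rewrite [phi u * a]mulrC.
Qed.

Lemma teq_slice_r (phi : V -> K^o) s t : linear phi -> teq s t ->
  \sum_(p <- s) phi p.2 *: p.1 = \sum_(p <- t) phi p.2 *: p.1.
Proof.
move=> lphi st; apply: (st U (fun u v => phi v *: u)).
split=> [v|u] a x y; rewrite ?lphi ?scalerDl ?scalerDr ?scalerA //.
by rewrite [phi v * a]mulrC.
Qed.

End Basic.

Lemma tswapK (U V : lmodType K) : cancel (@tswap U V) (@tswap V U).
Proof. by elim=> [|[u v] s /= ->]. Qed.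

Section LeftSpan.
Variables U V : lmodType K.
Implicit Types s t : seq (U * V).

Fixpoint lspan s (u : U) : Prop :=
  if s is q :: s' then exists c : K, lspan s' (u - c *: q.1) else u = 0.

Lemma lspan_subspace s : subspace (lspan s).
Proof.
elim: s => [|q s [z l]] /=; first by split=> // a x y -> ->; rewrite scaler0 addr0.
split; first by exists 0; rewrite scale0r subr0.
move=> a x y [c sx] [d sy]; exists (a * c + d).
have -> : a *: x + y - (a * c + d) *: q.1 = a *: (x - c *: q.1) + (y - d *: q.1).
  by rewrite scalerBr scalerA scalerDl opprD addrACA.
exact: l.
Qed.

Lemma lspan_mem s q : q \in s -> lspan s q.1.
Proof.
elim: s => //= p s IHs; rewrite inE => /predU1P[->|qs].
  by exists 1; rewrite scale1r subrr; case: (lspan_subspace s).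
by exists 0; rewrite scale0r subr0; apply: IHs.
Qed.

(** If [u] is a combination of the left factors with coefficients c_i, the summand [(u, v)]
    disappears once c_i v is added to the i-th right factor. *)
Lemma lspan_absorb s u v : lspan s u ->
  exists2 s', size s' = size s & teq ((u, v) :: s) s'.
Proof.
elim: s u v => [|q s IHs] u v /= => [->|[c su]].
  exists [::] => // W f bf.
  by rewrite big_cons big_nil /= (lin0 (bilin_l _ bf)) addr0.
have [s' sz e] := IHs _ v su.
exists ((q.1, q.2 + c *: v) :: s'); first by rewrite /= sz.
move=> W f bf; rewrite [RHS]big_cons -(e W f bf) !big_cons /=.
rewrite (linB (bilin_l _ bf)) (linZ (bilin_l _ bf)).
rewrite (linD (bilin_r _ bf)) (linZ (bilin_r _ bf)).
by rewrite !addrA; congr (_ + _); rewrite (addrAC (f q.1 q.2)) addrK addrC.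
Qed.

(* A representation of minimal length has linearly independent left factors,
   so each right factor is a slice of the tensor. *)
Lemma minimal_slices (P : V -> Prop) t :
  (forall s, teq t s -> size t <= size s)%N ->
  (forall phi : U -> K^o, linear phi -> P (\sum_(p <- t) phi p.1 *: p.2)) ->
  forall p, p \in t -> P p.2.
Proof.
move=> tmin Pt p pt; have tE := perm_to_rem pt.
have [sp|nsp] := pselect (lspan (rem p t) p.1).
  have [s' sz e] := lspan_absorb p.2 sp.
  have ts' : teq t s'.
    by apply: teq_trans e; rewrite -surjective_pairing; apply: perm_teq.
  by have := tmin s' ts'; rewrite sz (perm_size tE) /= ltnn.
have [phi [lphi phi0 phi1]] := separating_functional (lspan_subspace _) nsp.
have := Pt phi lphi; rewrite (perm_big _ tE) big_cons /= phi1 scale1r.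
rewrite big_seq big1 ?addr0 // => q qs.
by rewrite phi0 ?scale0r //; apply: lspan_mem.
Qed.

End LeftSpan.

(** The right factors of a shortest representation are slices of the tensor, and swapping the two
    sides handles the left factors. This is the tool for showing that an intersection is a
    subcoalgebra. *)
Lemma in_tensor_slices (V : lmodType K) (P : V -> Prop) (t : seq (V * V)) :
  (forall phi : V -> K^o, linear phi ->
     P (\sum_(p <- t) phi p.1 *: p.2) /\ P (\sum_(p <- t) phi p.2 *: p.1)) ->
  in_tensor P t.
Proof.
move=> Pt.
have [t' [tt' tmin]] : exists t', teq t t' /\
    forall s, teq t' s -> (size t' <= size s)%N.
  have [n] := ubnP (size t); elim: n t {Pt} => // n IHn t szt.
  have [|] := pselect (exists s, teq t s /\ (size s < size t)%N).
    case=> s [ts szs]; have [|t' [st' t'min]] := IHn s.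
      exact: leq_trans szs _.
    by exists t'; split=> //; apply: teq_trans st'.
  move=> nos; exists t; split=> // s ts; rewrite leqNgt; apply/negP => szs.
  by apply: nos; exists s.
exists t'; split=> // p pt'; split; last first.
  apply: (minimal_slices tmin) pt' => phi lphi.
  by rewrite -(teq_slice_l lphi tt'); case: (Pt phi lphi).
have pt'' : (p.2, p.1) \in tswap t'.
  by apply/mapP; exists p.
apply: (@minimal_slices _ _ P (tswap t') _ _ (p.2, p.1)) => // [s t's|phi lphi].
  rewrite size_map (leq_trans (tmin (tswap s) _)) ?size_map //.
  by rewrite -(tswapK t'); apply: tswap_teq.
rewrite big_map /= -(teq_slice_r lphi tt').
by case: (Pt phi lphi).
Qed.

Section TensorProduct.
Variables U V : algType K.

Lemma teq_tmul (s s' t t' : seq (U * V)) :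
  teq s s' -> teq t t' -> teq (tmul s t) (tmul s' t').
Proof.
move=> ss tt W f bf; rewrite !big_allpairs_dep /=.
transitivity (\sum_(p <- s) \sum_(q <- t') f (p.1 * q.1) (p.2 * q.2)).
  apply: eq_bigr => p _.
  apply: (tt W (fun u v => f (p.1 * u) (p.2 * v))); split=> [v|u] a x y.
    by rewrite mulrDr -scalerAr bf.1.
  by rewrite mulrDr -scalerAr bf.2.
rewrite exchange_big /= [RHS]exchange_big /=; apply: eq_bigr => q _.
apply: (ss W (fun u v => f (u * q.1) (v * q.2))); split=> [v|u] a x y.
  by rewrite mulrDl -scalerAl bf.1.
by rewrite mulrDl -scalerAl bf.2.
Qed.

End TensorProduct.
End Tensors.

(** * The convolution product *)

Section Convolution.
Variables (K : fieldType) (V : lmodType K) (D : V -> seq (V * V)) (e : V -> K).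
Variable R : algType K.
Implicit Types f g h : V -> R.

Definition conv f g (x : V) : R := \sum_(p <- D x) f p.1 * g p.2.

Definition cunit (x : V) : R := e x *: 1.

Lemma bilin_mul (U W : lmodType K) (f : U -> R) (g : W -> R) :
  linear f -> linear g -> bilin (fun u v => f u * g v).
Proof.
move=> lf lg; split=> [v|u] a x y.
  by rewrite lf mulrDl scalerAl.
by rewrite lg mulrDr scalerAr.
Qed.

Lemma conv_sumr (I : Type) (r : seq I) f (G : I -> V -> R) x :
  conv f (fun y => \sum_(i <- r) G i y) x = \sum_(i <- r) conv f (G i) x.
Proof. by rewrite exchange_big; apply: eq_bigr => p _; rewrite mulr_sumr. Qed.

Lemma conv_suml (I : Type) (r : seq I) (G : I -> V -> R) g x :
  conv (fun y => \sum_(i <- r) G i y) g x = \sum_(i <- r) conv (G i) g x.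
Proof. by rewrite exchange_big; apply: eq_bigr => p _; rewrite mulr_suml. Qed.

Hypothesis coD : is_coalg D e.

Lemma counit_linear : linear (e : V -> K^o).
Proof. by move=> a x y; apply: coD.2.1. Qed.

Lemma cunit_linear : linear cunit.
Proof.
by move=> a x y; rewrite /cunit counit_linear scalerDl scalerA.
Qed.

Lemma conv_linear f g : linear f -> linear g -> linear (conv f g).
Proof.
move=> lf lg a x y; have bfg := bilin_mul lf lg.
rewrite /conv (coD.1 a x y _ _ bfg) big_cat big_map /= scaler_sumr.
by congr (_ + _); apply: eq_bigr => p _; rewrite (linZ lf) scalerAl.
Qed.

Lemma conv_assoc f g h : linear f -> linear g -> linear h ->
  conv f (conv g h) = conv (conv f g) h.
Proof.
move=> lf lg lh; apply/funext => x.
pose F u v w := f u * g v * h w.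
have tF : trilin F.
  split; last split; move=> u v a y z; rewrite /F.
  - by rewrite lf !mulrDl -!scalerAl.
  - by rewrite lg mulrDr mulrDl -scalerAr -scalerAl.
  - by rewrite lh mulrDr -scalerAr.
have := coD.2.2.1 x R F tF; rewrite !big_allpairs_dep /= => E.
transitivity (\sum_(p <- D x) \sum_(q <- D p.2) F p.1 q.1 q.2).
  apply: eq_bigr => p _; rewrite mulr_sumr.
  by apply: eq_bigr => q _; rewrite mulrA.
by rewrite E; apply: eq_bigr => p _; rewrite mulr_suml.
Qed.

Lemma conv1l f : linear f -> conv cunit f = f.
Proof.
move=> lf; apply/funext => x; rewrite -[in RHS](coD.2.2.2 x).1 (lin_sum lf).
by apply: eq_bigr => p _; rewrite (linZ lf) -scalerAl mul1r.
Qed.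

Lemma conv1r f : linear f -> conv f cunit = f.
Proof.
move=> lf; apply/funext => x; rewrite -[in RHS](coD.2.2.2 x).2 (lin_sum lf).
by apply: eq_bigr => p _; rewrite (linZ lf) -scalerAr mulr1.
Qed.

Lemma conv_inverse_unique f g h : linear f -> linear g -> linear h ->
  conv g f = cunit -> conv f h = cunit -> g = h.
Proof.
by move=> lf lg lh gf fh; rewrite -(conv1r lg) -fh conv_assoc // gf conv1l.
Qed.

End Convolution.

(** * Filtered coalgebras *)

Lemma nested_leq (T : Type) (F : nat -> T -> Prop) :
  (forall n x, F n x -> F n.+1 x) ->
  forall i n x, (i <= n)%N -> F i x -> F n x.
Proof.
move=> FS i n x; elim: n => [|n IHn]; first by rewrite leqn0 => /eqP->.
by rewrite leq_eqVlt => /predU1P[->//|lein] Fx; apply: FS; apply: IHn.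
Qed.

Section FilteredCoalgebra.
Variables (K : fieldType) (V : lmodType K) (D : V -> seq (V * V)) (e : V -> K).
Variable F : nat -> V -> Prop.

Definition filtered_tensor (n : nat) (t : seq (V * V)) : Prop :=
  exists2 t', teq t t' & forall p, p \in t' ->
    exists i j, [/\ F i p.1, F j p.2 & (i + j)%N = n].

Definition coalg_filtration : Prop :=
  [/\ forall n, subspace (F n),
      forall n x, F n x -> F n.+1 x,
      forall x, exists n, F n x
    & forall n x, F n x -> filtered_tensor n (D x)].

Hypothesis coD : is_coalg D e.
Hypothesis filF : coalg_filtration.

(* Slicing the coproduct of x by a functional that kills F 0 lowers the
   filtration degree of x without leaving C. *)
Lemma subcoalg_meets_F0 (C : V -> Prop) x : subcoalg D C -> C x -> x != 0 ->
  exists y, [/\ C y, F 0%N y & y != 0].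
Proof.
move=> [sC DC]; have [sF FS Fall FD] := filF; have [n Fx] := Fall x.
elim: n x Fx => [|n IHn] x Fx Cx x0; first by exists x.
have [F0x|nF0x] := pselect (F 0 x); first by exists x.
have [phi [lphi phi0 phi1]] := separating_functional (sF 0%N) nF0x.
apply: (IHn (\sum_(p <- D x) phi p.1 *: p.2)).
- have [t' tt' Ft'] := FD _ _ Fx; rewrite (teq_slice_l lphi tt').
  apply: (subspace_sum (sF n)) => p /Ft'[i [j [Fi Fj ijn]]].
  case: i Fi ijn => [/phi0-> _|i _ ijn]; first by rewrite scale0r; apply: (sF n).1.
  apply: (subspaceZ (sF n)); apply: (nested_leq FS) Fj.
  by move: ijn; rewrite addSn => -[<-]; apply: leq_addl.
- have [t' [tt' Ct']] := DC _ Cx; rewrite (teq_slice_l lphi tt').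
  by apply: (subspace_sum sC) => p /Ct'[_ ?]; apply: subspaceZ.
(* The counit of the slice is [phi x], that is 1, so the slice is nonzero. *)
- have le := counit_linear coD.
  apply: contra_neq (oner_neq0 K) => y0.
  have := congr1 (e : V -> K^o) y0; rewrite (lin0 le) (lin_sum le) => <-.
  have := (coD.2.2.2 x).2 => /(congr1 phi); rewrite phi1 (lin_sum lphi) => <-.
  by apply: eq_bigr => p _; rewrite (linZ lphi) (linZ le); apply: mulrC.
Qed.

(** * Convolution inverses from a geometric series *)

Section GeometricSeries.
Variables (R : algType K) (u : V -> R).
Hypotheses (lu : linear u) (u0 : forall x, F 0%N x -> u x = cunit e R x).

Local Notation "f ** g" := (conv D f g) (at level 40).
Local Notation one := (@cunit K V e R).
Let gamma x := one x - u x.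
Let cpow k : V -> R := iter k (conv D gamma) one.
Let psum N x := \sum_(k < N.+1) cpow k x.

Let l1 : linear one := cunit_linear R coD.

Let lgamma : linear gamma.
Proof. by move=> a x y; rewrite /gamma l1 lu opprD addrACA scalerBr. Qed.

Let lcpow k : linear (cpow k).
Proof. by elim: k => // k IHk; apply: (conv_linear coD lgamma IHk). Qed.

Let conv_gammal f x : linear f -> (gamma ** f) x = f x - (u ** f) x.
Proof.
move=> lf; rewrite -[in f x](conv1l coD lf) -sumrB.
by apply: eq_bigr => p _; rewrite -mulrBl.
Qed.

Let conv_gammar f x : linear f -> (f ** gamma) x = f x - (f ** u) x.
Proof.
move=> lf; rewrite -[in f x](conv1r coD lf) -sumrB.
by apply: eq_bigr => p _; rewrite -mulrBr.
Qed.

(** Powers are built by multiplying on the left; commuting with [gamma] makes the series a left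
    inverse of [u] as well. *)
Let cpowSr k : cpow k ** gamma = cpow k.+1.
Proof.
elim: k => [|k IHk]; first by rewrite /cpow /= (conv1l coD) // (conv1r coD).
change (gamma ** cpow k ** gamma = gamma ** cpow k.+1).
by rewrite -IHk (conv_assoc coD).
Qed.

(** In the coproduct of an element of degree [n], [gamma] kills the terms of left degree 0, and the
    other terms have right degree below [n], where induction applies. *)
Let cpow_vanish n k x : F n x -> (n < k)%N -> cpow k x = 0.
Proof.
case: filF => _ _ _ FD; elim: k n x => // k IHk n x Fx; rewrite ltnS => lenk.
have [t tt Ft] := FD _ _ Fx.
rewrite /cpow /= /conv (tt _ _ (bilin_mul lgamma (lcpow k))) big_seq big1 //.
move=> p /Ft[i [j [Fi Fj ijn]]]; case: i Fi ijn => [F0 _|i _ ijn].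
  by rewrite /gamma u0 // subrr mul0r.
rewrite (IHk j) ?mulr0 //; apply: leq_trans lenk.
by rewrite -ijn addSn ltnS leq_addl.
Qed.

Let lpsum N : linear (psum N).
Proof.
move=> a x y; rewrite /psum scaler_sumr -big_split.
by apply: eq_bigr => k _; rewrite lcpow.
Qed.

Let psum_stable n N x : F n x -> (n <= N)%N -> psum N x = psum n x.
Proof.
move=> Fx; elim: N => [|N IHN]; first by rewrite leqn0 => /eqP->.
rewrite leq_eqVlt => /predU1P[->//|lenN].
by rewrite /psum big_ord_recr (cpow_vanish Fx) //= addr0; apply: IHN.
Qed.

Let psum_telescope N x : psum N x - \sum_(k < N.+1) cpow k.+1 x = one x - cpow N.+1 x.
Proof.
by rewrite /psum big_ord_recl big_ord_recr /= opprD addrA addrK.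
Qed.

Lemma filtered_conv_invertible :
  exists v : V -> R, [/\ linear v, u ** v = one & v ** u = one].
Proof.
have [_ _ Fall _] := filF; have [deg Fdeg] := choice Fall.
(* The series is cut at a chosen degree bound of [x]; any later cut gives the same value. *)
pose v x := psum (deg x) x.
have vE N x : (deg x <= N)%N -> v x = psum N x.
  by move=> le; rewrite (psum_stable (Fdeg x) le).
have tele N x : (deg x <= N)%N -> psum N x - \sum_(k < N.+1) cpow k.+1 x = one x.
  by move=> le; rewrite psum_telescope (cpow_vanish (Fdeg x)) ?subr0.
exists v; split.
- move=> a x y.
  pose N := maxn (deg (a *: x + y)) (maxn (deg x) (deg y)).
  rewrite !(vE N) ?lpsum // !leq_max leqnn ?orbT //.
(* [N] bounds the degrees of [x] and of the right factors in [D x], so the single linear map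
   [psum N] can replace [v]. Then u ** psum N = psum N - gamma ** psum N telescopes to the unit at
   [x]. *)
- apply/funext => x; pose N := maxn (deg x) (\max_(p <- D x) deg p.2).
  have -> : (u ** v) x = (u ** psum N) x.
    rewrite /conv big_seq [RHS]big_seq; apply: eq_bigr => p pD; rewrite (vE N) //.
    by rewrite leq_max (leq_bigmax_seq _ pD) ?orbT.
  rewrite -(tele N) ?leq_maxl // -[LHS](subKr (psum N x)) -conv_gammal //.
  by rewrite conv_sumr.
- apply/funext => x; pose N := maxn (deg x) (\max_(p <- D x) deg p.1).
  have -> : (v ** u) x = (psum N ** u) x.
    rewrite /conv big_seq [RHS]big_seq; apply: eq_bigr => p pD; rewrite (vE N) //.
    by rewrite leq_max (leq_bigmax_seq _ pD) ?orbT.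
  rewrite -(tele N) ?leq_maxl // -[LHS](subKr (psum N x)) -conv_gammar //.
  by rewrite conv_suml; under eq_bigr do rewrite cpowSr.
Qed.

End GeometricSeries.

(** The series inverts both products of [f] and [g]. Hence [f] has a right inverse starting with [g]
    and a left inverse ending in [g], and associativity identifies them. *)
Lemma conv_invertible_on_F0 (R : algType K) (f g : V -> R) :
  linear f -> linear g ->
  (forall x, F 0%N x -> conv D f g x = cunit e R x /\ conv D g f x = cunit e R x) ->
  exists v : V -> R,
    [/\ linear v, conv D f v = cunit e R & conv D v f = cunit e R].
Proof.
move=> lf lg fg0.
have [v [lv fgv _]] := filtered_conv_invertible (conv_linear coD lf lg)
  (fun x Fx => (fg0 x Fx).1).
have [w [lw _ wgf]] := filtered_conv_invertible (conv_linear coD lg lf)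
  (fun x Fx => (fg0 x Fx).2).
have lgv := conv_linear coD lg lv; have lwg := conv_linear coD lw lg.
have fgvE : conv D f (conv D g v) = cunit e R by rewrite (conv_assoc coD).
have wgfE : conv D (conv D w g) f = cunit e R by rewrite -(conv_assoc coD).
exists (conv D g v); split=> //.
by rewrite -(conv_inverse_unique coD lf lwg lgv wgfE fgvE).
Qed.

End FilteredCoalgebra.

(** * Lines spanned by group-like elements *)

Section GroupLikeLines.
Variables (K : fieldType) (V : lmodType K) (D : V -> seq (V * V)) (e : V -> K).
Hypothesis coD : is_coalg D e.

Lemma grouplike_line_subcoalg (g : V) : teq (D g) [:: (g, g)] ->
  subcoalg D (fun x => exists a : K, x = a *: g).
Proof.
move=> Dg; split.
  split; first by exists 0; rewrite scale0r.
  by move=> a _ _ [b ->] [c ->]; exists (a * b + c); rewrite scalerDl scalerA.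
(* Linearity of [D] is stated for [a *: x + y]; the witness comes from writing a g = (a - 1) g +
   g. *)
move=> _ [a ->]; exists (tscale (a - 1) [:: (g, g)] ++ [:: (g, g)]); split.
  have -> : a *: g = (a - 1) *: g + g by rewrite scalerBl scale1r subrK.
  by apply: teq_trans (coD.1 _ _ _) _; apply: teq_cat => //; apply: teq_tscale.
by move=> p; rewrite !inE => /orP[/eqP->|/eqP->] /=; split;
  by [exists (a - 1)|exists 1; rewrite scale1r].
Qed.

Lemma grouplike_line_simple (g : V) : grouplike D g ->
  simple_subcoalg D (fun x => exists a : K, x = a *: g).
Proof.
move=> [g0 Dg]; split; first exact: grouplike_line_subcoalg.
split; first by exists g; split=> //; exists 1; rewrite scale1r.
move=> C' [sC' _] C'g [y [C'y y0]] _ [a ->].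
have [b yE] := C'g _ C'y; have b0 : b != 0.
  by apply: contra_neq y0 => b0; rewrite yE b0 scale0r.
by apply: subspaceZ => //; rewrite -[g](scalerK b0) -yE; apply: subspaceZ.
Qed.

End GroupLikeLines.

(** * Identities in a Poisson algebra *)

Section PoissonAlgebra.
Variables (K : fieldType) (A : comAlgType K) (pb : A -> A -> A).
Hypothesis pbP : is_poisson pb.

Lemma pb_anti x y : pb x y = - pb y x.
Proof.
have [bpb [pb0 _]] := pbP; apply/eqP; rewrite -addr_eq0; apply/eqP.
have := pb0 (x + y); rewrite (linD (bilin_l _ bpb)) !(linD (bilin_r _ bpb)).
by rewrite !pb0 add0r addr0.
Qed.

Lemma pb_mulr x y z : pb x (y * z) = pb x y * z + y * pb x z.
Proof.
have [_ [_ [_ pbM]]] := pbP.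
by rewrite pb_anti pbM opprD -mulrN -mulNr -!pb_anti addrC.
Qed.

(** The Jacobi identity is rearranged as a commutator of the operators {x, -} and {y, -}, the form
    required by the relation for [h (pb x y)]. *)
Lemma pb_jacobi x y z : pb (pb x y) z = pb x (pb y z) - pb y (pb x z).
Proof.
have [bpb [_ [jac _]]] := pbP; have := jac x y z.
rewrite (pb_anti z x) (linN (bilin_r _ bpb)) (pb_anti z (pb x y)) => /eqP.
by rewrite subr_eq0 => /eqP.
Qed.

End PoissonAlgebra.

(** * The enveloping algebra: retraction and filtration *)

Section EnvelopingAlgebra.
Variables (K : fieldType) (A : comAlgType K) (pb : A -> A -> A).
Variables (U : algType K) (m h : A -> U).
Hypothesis pbP : is_poisson pb.
Hypothesis UP : is_PEA pb m h.

Let m_lin : linear m. Proof. by case: UP => -[]. Qed.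
Let h_lin : linear h. Proof. by case: UP => -[_ []]. Qed.

Lemma true_subspace (V : lmodType K) : subspace (fun _ : V => True).
Proof. by []. Qed.

Let lmul_lin (B : algType K) (b : B) : linear ( *%R b).
Proof. by move=> c x y; rewrite mulrDr scalerAr. Qed.

(* A is a U-module, with m_a acting by multiplication and h_a by {a, -};
   the retraction is the orbit map of 1. *)
Lemma pea_retraction : exists r : U -> A, linear r /\ cancel m r.
Proof.
have [bpb _] := pbP.
pose m' a := StabEnd (true_subspace A) (@lmul_lin A a) (fun _ => id).
pose h' a := StabEnd (true_subspace A) (bilin_r a bpb) (fun _ => id).
have [|f [[fL [_ _]] [fm _]]] := UP.2 _ m' h'.
  split; [|split; [|split; [|split; [|split; [|split]]]]].
  - by move=> c x y; apply: stab_endP => z /=; rewrite mulrDl scalerAl.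
  - by move=> c x y; apply: stab_endP => z; apply: bpb.1.
  - by move=> x y; apply: stab_endP => z /=; rewrite mulrA.
  - move=> x y; apply: stab_endP => z.
    by rewrite stab_addE stab_oppE !stab_mulE /= pb_jacobi.
  - move=> x y; apply: stab_endP => z.
    rewrite stab_addE !stab_mulE /=; case: pbP => _ [_ [_ ->]].
    by rewrite addrC [pb x z * y]mulrC.
  - move=> x y; apply: stab_endP => z.
    by rewrite stab_addE stab_oppE !stab_mulE /= pb_mulr // addrK.
  - by apply: stab_endP => z /=; rewrite mul1r.
exists (fun x => f x 1); split; first by move=> c x y; rewrite fL.
by move=> a; rewrite fm /= mulr1.
Qed.

(** The degree bounds the number of [h] factors. Generating the filtration inductively reduces
    claims about it to generators, linear combinations and products. *)
Inductive pea_filt : nat -> U -> Prop :=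
| pea_filt_m a : pea_filt 0 (m a)
| pea_filt_h a : pea_filt 1 (h a)
| pea_filt_lin n c x y :
    pea_filt n x -> pea_filt n y -> pea_filt n (c *: x + y)
| pea_filt_mul i j x y :
    pea_filt i x -> pea_filt j y -> pea_filt (i + j) (x * y)
| pea_filtS n x : pea_filt n x -> pea_filt n.+1 x.

(** Neither [h] nor a degree shift can produce degree 0, and m(A) is closed under linear
    combinations and products. *)
Lemma pea_filt0 x : pea_filt 0 x <-> exists a, x = m a.
Proof.
split=> [|[a ->]]; last exact: pea_filt_m.
have [[_ [_ [mM _]]] _] := UP.
suff: forall n, pea_filt n x -> n = 0%N -> exists a, x = m a.
  by move=> H /H; apply.
move=> n; elim=> {n x} [a|//|n c x y _ IHx _ IHy n0|i j x y _ IHx _ IHy|//].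
- by exists a.
- have [a ->] := IHx n0; have [b ->] := IHy n0.
  by exists (c *: a + b); rewrite m_lin.
- move/eqP; rewrite addn_eq0 => /andP[/eqP/IHx[a ->] /eqP/IHy[b ->]].
  by exists (a * b); rewrite mM.
Qed.

Lemma pea_filt_subspace n : subspace (pea_filt n).
Proof.
split; last by move=> a x y; apply: pea_filt_lin.
elim: n => [|n]; last exact: pea_filtS.
by rewrite -(lin0 m_lin); apply: pea_filt_m.
Qed.

Let union_subspace : subspace (fun x => exists n, pea_filt n x).
Proof.
split; first by exists 0%N; apply: (pea_filt_subspace 0).1.
move=> a x y [i Fx] [j Fy]; exists (maxn i j).
by apply: pea_filt_lin; [apply: (nested_leq pea_filtS) Fx|apply: (nested_leq pea_filtS) Fy];
  rewrite leq_max leqnn ?orbT.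
Qed.

(** Allowing any invariant subspace lets this serve both the union of the filtration and the whole
    of [U]. *)
Let lmul_pea_rel (W : U -> Prop) (sW : subspace W) (m' h' : A -> stab_end sW) :
  (forall a, m' a =1 *%R (m a)) -> (forall a, h' a =1 *%R (h a)) ->
  pea_rel pb m' h'.
Proof.
move=> m'E h'E; have [[_ [_ [mM [hpb [hM [mpb m1]]]]]] _] := UP.
split; [|split; [|split; [|split; [|split; [|split]]]]].
- by move=> c x y; apply: stab_endP => z;
    rewrite stab_addE stab_scaleE !m'E m_lin mulrDl scalerAl.
- by move=> c x y; apply: stab_endP => z;
    rewrite stab_addE stab_scaleE !h'E h_lin mulrDl scalerAl.
- by move=> x y; apply: stab_endP => z; rewrite stab_mulE !m'E mM mulrA.
- by move=> x y; apply: stab_endP => z;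
    rewrite stab_addE stab_oppE !stab_mulE !h'E hpb mulrBl !mulrA.
- by move=> x y; apply: stab_endP => z;
    rewrite stab_addE !stab_mulE !m'E !h'E hM mulrDl !mulrA.
- by move=> x y; apply: stab_endP => z;
    rewrite stab_addE stab_oppE !stab_mulE !(m'E, h'E) mpb mulrBl !mulrA.
- by apply: stab_endP => z; rewrite m'E m1 mul1r.
Qed.

(* Left multiplication on U, compared through the
   universal property with a morphism into the endomorphisms preserving the
   union of the filtration, preserves that union, which contains 1. *)
Lemma pea_filt_exhaustive x : exists n, pea_filt n x.
Proof.
pose W x := exists n, pea_filt n x; pose sW : subspace W := union_subspace.
have stm a y : W y -> W (m a * y).
  by case=> n Fy; exists (0 + n)%N; apply: pea_filt_mul => //; apply: pea_filt_m.
have sth a y : W y -> W (h a * y).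
  by case=> n Fy; exists (1 + n)%N; apply: pea_filt_mul => //; apply: pea_filt_h.
pose mW a := StabEnd sW (@lmul_lin U (m a)) (stm a).
pose hW a := StabEnd sW (@lmul_lin U (h a)) (sth a).
have [|f [[fL [fM f1]] [fm [fh _]]]] := UP.2 _ mW hW; first exact: lmul_pea_rel.
pose L x := StabEnd (true_subspace U) (@lmul_lin U x) (fun _ => id).
have [|k [_ [_ [_ kuniq]]]] := UP.2 _ (L \o m) (L \o h).
  exact: lmul_pea_rel.
have Lk y : L y = k y.
  apply: kuniq => //; split; [|split] => [c u v|u v|]; apply: stab_endP => z /=.
  - by rewrite mulrDl scalerAl.
  - by rewrite mulrA.
  - by rewrite mul1r.
pose forget y := StabEnd (true_subspace U) (stab_lin (f y)) (fun _ => id).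
have fk y : forget y = k y.
  apply: kuniq; first split; [|split| |] => [c u v|u v||a|a];
    by apply: stab_endP => z /=; rewrite ?(fL, fM, f1, fm, fh).
(* [f x] is left multiplication by [x], so its value at 1 is [x]; and 1 = m 1 has degree 0. *)
have -> : x = f x 1.
  by rewrite -[RHS]/(forget x 1) fk -Lk /= mulr1.
apply: (@stab_stable _ _ W sW (f x) 1); exists 0%N; apply/pea_filt0; exists 1.
by case: UP => -[_ [_ [_ [_ [_ [_ ->]]]]]].
Qed.

(** * The bialgebra structure: group-likes, coradical, antipode *)

Section OhBialgebra.
Variables (DA : A -> seq (A * A)) (eA : A -> K).
Variables (DU : U -> seq (U * U)) (eU : U -> K).
Hypothesis OhU : oh_bialg m h DA eA DU eU.

(** The coproduct is linear and multiplicative, so only generators matter: each summand of D(h_a)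
    carries [h] in exactly one factor, and those of D(m_a) in none. *)
Lemma pea_coalg_filtration : coalg_filtration DU pea_filt.
Proof.
have [[[DL _] [DM _]] [Dm [Dh _]]] := OhU.
split; [exact: pea_filt_subspace|exact: pea_filtS|
        exact: pea_filt_exhaustive|].
move=> n x; elim=> {n x}.
- move=> a; exists [seq (m p.1, m p.2) | p <- DA a] => //.
  by move=> _ /mapP[p _ ->]; exists 0%N, 0%N; split=> //; apply: pea_filt_m.
- move=> a; exists (flatten
    [seq [:: (h p.1, m p.2); (m p.1, h p.2)] | p <- DA a]) => //.
  move=> q /flattenP[_ /mapP[p _ ->]]; rewrite !inE => /orP[] /eqP-> /=.
    by exists 1%N, 0%N; split=> //; [apply: pea_filt_h|apply: pea_filt_m].
  by exists 0%N, 1%N; split=> //; [apply: pea_filt_m|apply: pea_filt_h].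
- move=> n c x y _ [s xs Fs] _ [t yt Ft]; exists (tscale c s ++ t).
    apply: teq_trans (DL _ _ _) _; apply: teq_cat => //; exact: teq_tscale.
  move=> p; rewrite mem_cat => /orP[/mapP[q /Fs[i [j [Fi Fj ij]]] ->]|/Ft//].
  by exists i, j; split=> //; apply: subspaceZ => //; apply: pea_filt_subspace.
- move=> i j x y _ [s xs Fs] _ [t yt Ft]; exists (tmul s t).
    by apply: teq_trans (DM _ _) _; apply: teq_tmul.
  move=> _ /allpairsP[[p q] [/= /Fs[a [b [Fa Fb <-]]] /Ft[c [d [Fc Fd <-]]] ->]].
  exists (a + c)%N, (b + d)%N; split; last exact: addnACA.
    exact: pea_filt_mul.
  exact: pea_filt_mul.
- move=> n x _ [t xt Ft]; exists t => // p /Ft[i [j [Fi Fj <-]]].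
  by exists i.+1, j; split=> //; apply: pea_filtS.
Qed.

(** The line through a group-like [g] is a subcoalgebra, so it meets m(A) in a nonzero vector and
    [g] is some [m a]. The retraction then carries the coproduct identity back to [A]. *)
Lemma grouplike_pea g : grouplike DU g <-> exists a, grouplike DA a /\ g = m a.
Proof.
have [r [lr mK]] := pea_retraction.
have [[coU _] [Dm _]] := OhU.
split=> [[g0 Dg]|[a [[a0 Da] ->]]]; last first.
  split; first by rewrite -(lin0 m_lin) (inj_eq (can_inj mK)).
  exact: teq_trans (Dm a) (teq_map m_lin m_lin Da).
have Cg : exists c : K, g = c *: g by exists 1; rewrite scale1r.
have [y [[c yE] /pea_filt0[b yb] y0]] := subcoalg_meets_F0 coU
  pea_coalg_filtration (grouplike_line_subcoalg coU Dg) Cg g0.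
have c0 : c != 0 by apply: contra_neq y0 => c0; rewrite yE c0 scale0r.
pose a := c^-1 *: b.
have ga : g = m a by rewrite (linZ m_lin) -yb yE scalerA mulVf // scale1r.
exists a; split=> //; split.
  by apply: contra_neq g0 => a0; rewrite ga a0 (lin0 m_lin).
move: (Dg); rewrite {1}ga => Dma.
have := teq_map lr lr (teq_trans (teq_sym (Dm a)) Dma).
rewrite -map_comp /= ga mK; under eq_map => p do rewrite /= !mK -surjective_pairing.
by rewrite map_id.
Qed.

(** [C] meets m(A) in a nonzero subcoalgebra, which is all of [C] by simplicity. As [m] is an
    injective coalgebra map, a smaller subcoalgebra of the preimage would have a smaller image
    inside [C]. *)
Lemma simple_subcoalg_pea C : simple_subcoalg DU C ->
  (forall x, C x -> exists a, x = m a) /\ simple_subcoalg DA (fun a => C (m a)).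
Proof.
have [r [lr mK]] := pea_retraction.
have [[coU _] [Dm _]] := OhU.
move=> [[sC DC] [[x0 [Cx0 nz_x0]] Cmin]].
have F0sub : subspace (pea_filt 0) := pea_filt_subspace 0.
have Cm : forall x, C x -> exists a, x = m a.
  move=> x Cx; apply/pea_filt0.
  pose C' y := C y /\ pea_filt 0 y.
  suff: C' x by case.
  apply: Cmin => //; [|by move=> y []|]; last first.
    have [y [Cy Fy y0]] := subcoalg_meets_F0 coU pea_coalg_filtration
      (conj sC DC) Cx0 nz_x0.
    by exists y.
  split.
    split; first by split; [apply: sC.1|apply: F0sub.1].
    by move=> a y z [Cy Fy] [Cz Fz]; split; [apply: sC.2|apply: F0sub.2].
  (* Slices of [DU y] lie in [C] because [C] is a subcoalgebra, and in m(A) because [y = m a]. *)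
  move=> y [Cy /pea_filt0[a ya]]; apply: in_tensor_slices => phi lphi.
  have [t [yt Ct]] := DC _ Cy.
  have Dy : teq (DU y) [seq (m p.1, m p.2) | p <- DA a] by rewrite ya.
  split; split.
  - rewrite (teq_slice_l lphi yt); apply: subspace_sum => // p /Ct[_ ?].
    exact: subspaceZ.
  - rewrite (teq_slice_l lphi Dy) big_map; apply: subspace_sum => // p _.
    by apply: subspaceZ => //; apply: pea_filt_m.
  - rewrite (teq_slice_r lphi yt); apply: subspace_sum => // p /Ct[? _].
    exact: subspaceZ.
  - rewrite (teq_slice_r lphi Dy) big_map; apply: subspace_sum => // p _.
    by apply: subspaceZ => //; apply: pea_filt_m.
have mrC u : C u -> m (r u) = u by case/Cm=> a ->; rewrite mK.
split=> //; split; [split|split].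
- split; first by rewrite (lin0 m_lin); apply: sC.1.
  by move=> a x y Cx Cy; rewrite m_lin; apply: sC.2.
- move=> a Ca; have [t [Dat Ct]] := DC _ Ca.
  exists [seq (r p.1, r p.2) | p <- t]; split; last first.
    by move=> _ /mapP[p /Ct[Cp1 Cp2] ->]; rewrite /= !mrC.
  have := teq_map lr lr (teq_trans (teq_sym (Dm a)) Dat).
  rewrite -map_comp; under eq_map => p do rewrite /= !mK -surjective_pairing.
  by rewrite map_id.
- have [a x0a] := Cm _ Cx0; exists a; rewrite -x0a; split=> //.
  by apply: contra_neq nz_x0 => a0; rewrite x0a a0 (lin0 m_lin).
- move=> C' [sC' DC'] C'C [a' [C'a' nz_a']] a Ca.
  have [|||b [C'b /(can_inj mK)-> //]] :=
      Cmin (fun x => exists a, C' a /\ x = m a) _ _ _ _ Ca.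
  + split; first split.
    * by exists 0; rewrite (lin0 m_lin); split=> //; apply: sC'.1.
    * move=> c _ _ [x [Cx ->]] [y [Cy ->]]; exists (c *: x + y).
      by rewrite m_lin; split=> //; apply: sC'.2.
    * move=> _ [b [C'b ->]]; have [t [bt Ct]] := DC' _ C'b.
      exists [seq (m p.1, m p.2) | p <- t]; split.
        exact: teq_trans (Dm b) (teq_map m_lin m_lin bt).
      by move=> _ /mapP[p /Ct[Cp1 Cp2] ->]; split; [exists p.1|exists p.2].
  + by move=> _ [b [/C'C Cb ->]].
  + exists (m a'); split; first by exists a'.
    by rewrite -(lin0 m_lin) (inj_eq (can_inj mK)).
Qed.

(** The line of 1 is simple since 1 is group-like. Conversely, every simple subcoalgebra is the
    image of one of [A], hence consists of multiples of m 1 = 1. *)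
Lemma connected_pea : connected DA -> connected DU.
Proof.
have [[coU [_ [D1 _]]] _] := OhU.
have m1 : m 1 = 1 by case: UP => -[_ [_ [_ [_ [_ [_ ->]]]]]].
move=> cA x; split=> [[s [sP ->]]|[a ->]]; last first.
  exists [:: a *: 1]; split; last by rewrite big_seq1.
  move=> y; rewrite inE => /eqP->.
  exists (fun x => exists a : K, x = a *: 1); split; last by exists a.
  by apply: (grouplike_line_simple coU); split=> //; apply: oner_neq0.
apply: (@subspace_sum _ _ (fun x => exists a : K, x = a *: 1)).
  by case: (grouplike_line_subcoalg coU D1).
move=> y /sP[C [simC Cy]]; have [Cm simA] := simple_subcoalg_pea simC.
have [b yb] := Cm _ Cy.
have [|c bc] := (cA b).1.
  exists [:: b]; split; last by rewrite big_seq1.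
  move=> z; rewrite inE => /eqP->.
  by exists (fun a => C (m a)); split=> //; rewrite -yb.
by exists c; rewrite yb bc (linZ m_lin) m1.
Qed.

(** An antipode is a convolution inverse of the identity. On m(A) the map m SA r is one, by the
    antipode identities of [A]; the filtration extends invertibility to all of [U]. *)
Lemma pea_antipode (SA : A -> A) : is_hopf DA eA SA ->
  exists SU : U -> U, is_hopf DU eU SU /\ (forall a, SU (m a) = m (SA a)).
Proof.
have [r [lr mK]] := pea_retraction.
have [biU [Dm [_ [em _]]]] := OhU; have [coU _] := biU.
move=> [[coA _] [lSA SAP]].
have [[_ [_ [mM [_ [_ [_ m1]]]]]] _] := UP.
have lid : linear (fun x : U => x) by [].
have lg : linear (fun x => m (SA (r x))).
  by move=> c x y; rewrite lr lSA m_lin.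
have lmS : linear (fun a => m (SA a)) by move=> c x y; rewrite lSA m_lin.
have convm (f g : U -> U) a : linear f -> linear g ->
    conv DU f g (m a) = conv DA (f \o m) (g \o m) a.
  by move=> lf lg'; rewrite /conv (Dm a _ _ (bilin_mul lf lg')) big_map.
have mSl a : conv DA (fun a => m (SA a)) m a = cunit eA U a.
  rewrite /conv /cunit -m1 -(linZ m_lin) -(SAP a).1 (lin_sum m_lin).
  by apply: eq_bigr => p _; rewrite mM.
have mSr a : conv DA m (fun a => m (SA a)) a = cunit eA U a.
  rewrite /conv /cunit -m1 -(linZ m_lin) -(SAP a).2 (lin_sum m_lin).
  by apply: eq_bigr => p _; rewrite mM.
have [x /pea_filt0[a ->]|S [lS idS Sid]] :=
    conv_invertible_on_F0 coU pea_coalg_filtration lid lg.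
  split; rewrite convm // /cunit em -/(cunit eA U a);
    [rewrite -mSr|rewrite -mSl].
    by apply: eq_bigr => p _ /=; rewrite mK.
  by apply: eq_bigr => p _ /=; rewrite mK.
exists S; split; first split=> //; first split=> // x.
  by split; [have := congr1 (@^~ x) Sid|have := congr1 (@^~ x) idS].
(* Among linear maps from [A] to [U], [S \o m] is a left and m SA a right convolution inverse of
   [m], so they agree. *)
suff: S \o m = (fun a => m (SA a)) by move=> E a; apply: (congr1 (@^~ a) E).
apply: (conv_inverse_unique coA m_lin) => //; first exact: linear_comp lS m_lin.
  apply/funext => a; rewrite -[m in conv _ _ m]/((fun x => x) \o m) -convm // Sid.
  by rewrite /cunit em.
exact/funext.
Qed.

End OhBialgebra.
End EnvelopingAlgebra.

Theorem theorem2p3 (K : fieldType) (A : comAlgType K) (pb : A -> A -> A)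
  (DA : A -> seq (A * A)) (eA : A -> K) (SA : A -> A)
  (U : algType K) (m h : A -> U)
  (DU : U -> seq (U * U)) (eU : U -> K) :
  is_poisson_hopf pb DA eA SA ->
  is_PEA pb m h ->
  oh_bialg m h DA eA DU eU ->
  (* (iii) *)
  (pointed DA ->
     (exists SU : U -> U, is_hopf DU eU SU /\ (forall a, SU (m a) = m (SA a))) /\
     injective m /\
     (forall g, grouplike DU g <-> exists a, grouplike DA a /\ g = m a)) /\
  (* (iv) *)
  (connected DA ->
     (exists SU : U -> U, is_hopf DU eU SU) /\ connected DU).
Proof.
move=> [hopfA [pbP _]] UP OhU.
have [r [_ mK]] := pea_retraction pbP UP.
have [SU [hopfU SUm]] := pea_antipode pbP UP OhU hopfA.
split=> [_|cA].
  split; first by exists SU.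
  by split; [apply: can_inj mK|apply: (grouplike_pea pbP UP OhU)].
by split; [exists SU|apply: (connected_pea pbP UP OhU)].
Qed.
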